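(* If $D$ is a de Bruijn digraph $B(d,M)$ or a Kautz digraph $K(d,M)$, with integers $d\ge 2$ and $M\ge 1$, then $F(D)=|V(D)|-2$.
   Context: The de Bruijn digraph $B(d,M)$ has vertex set $\{x_0x_1\cdots x_{M-1}: x_i\in\mathbb{Z}_d\}$ and arcs $(x_0x_1\cdots x_{M-1},\ x_1x_2\cdots x_M)$ (with $x_0,\dots,x_M\in\mathbb{Z}_d$); it has loops. The Kautz digraph $K(d,M)$ has vertex set $\{x_0x_1\cdots x_{M-1}: x_i\in\mathbb{Z}_{d+1},\ x_i\ne x_{i+1}\}$ and arcs $(x_0x_1\cdots x_{M-1},\ x_1x_2\cdots x_M)$ (with $x_0,\dots,x_M\in\mathbb{Z}_{d+1}$ and $x_i\neq x_{i+1}$ for $0\le i\le M-1$); it has no loops. For a digraph $H=(V,A)$, $N_H^+(v)=\{u:(v,u)\in A\}$ (containing $v$ if there is a loop at $v$). Zero forcing on a digraph $H$ without loops: for $S\subseteq V$, $B^0(S)=S$ and $B^{i+1}(S)=B^i(S)\cup\{w:\{w\}=N_H^+(v)\setminus B^i(S)\text{ for some }v\in B^i(S)\}$. On a digraph $H$ with (at least one) loop, the rule is instead $B^{i+1}(S)=B^i(S)\cup\{w:\{w\}=N_H^+(v)\setminus B^i(S)\text{ for some }v\in V\}$. In either case $S$ is a zero forcing set (ZFS) if $B^t(S)=V$ for some $t\ge 0$, and a failed zero forcing set (FZFS) otherwise. $F(H)$ is the largest cardinality of an FZFS of $H$ (when one exists). *)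

(* Defs.v *)
From mathcomp Require Import all_boot.

Set Implicit Arguments.
Unset Strict Implicit.
Unset Printing Implicit Defensive.

(* A finite digraph is given by its arc relation [e : rel V] on a finite type
   of vertices; loops are allowed. *)

Definition out_nbhd (V : finType) (e : rel V) (v : V) : {set V} :=
  [set u | e v u].

Definition has_loop (V : finType) (e : rel V) : bool := [exists v, e v v].

(* The colour change rule depends on the digraph: if it has at least one loop,
   then every vertex may force; otherwise only the vertices of [B] may. *)
Definition zf_step (V : finType) (e : rel V) (B : {set V}) : {set V} :=
  B :|: [set w | [exists v, (has_loop e || (v \in B))
                            && (out_nbhd e v :\: B == [set w])]].

Definition zf_iter (V : finType) (e : rel V) (i : nat) (S : {set V}) : {set V} :=
  iter i (zf_step e) S.

Definition is_ZFS (V : finType) (e : rel V) (S : {set V}) : Prop :=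
  exists t : nat, zf_iter e t S = [set: V].

Definition is_FZFS (V : finType) (e : rel V) (S : {set V}) : Prop :=
  ~ is_ZFS e S.

(* F(e) is only defined when a failed zero forcing set exists, so "F(e) = k" is
   a relation, which includes the existence of such a set. *)
Definition failed_zf_number_is (V : finType) (e : rel V) (k : nat) : Prop :=
  (exists2 S : {set V}, is_FZFS e S & #|S| = k) /\
  (forall S : {set V}, is_FZFS e S -> #|S| <= k).

(* Z_d serves only as an alphabet of d letters, hence 'I_d. *)
Definition deBruijn_vertex (d M : nat) : finType := M.-tuple 'I_d.

(* The arcs come from the words w = x_0 ... x_M of length M + 1. *)
Definition deBruijn (d M : nat) : rel (deBruijn_vertex d M) :=
  fun u v => [exists w : M.+1.-tuple 'I_d,
    (take M w == u :> seq 'I_d) && (behead w == v :> seq 'I_d)].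

Definition kautz_word (d : nat) (s : seq 'I_d.+1) : bool :=
  sorted [rel x y | x != y] s.

Definition kautz_vertex (d M : nat) : finType :=
  {t : M.-tuple 'I_d.+1 | kautz_word t}.

Definition kautz (d M : nat) : rel (kautz_vertex d M) :=
  fun u v => [exists w : M.+1.-tuple 'I_d.+1,
    [&& kautz_word w, take M w == val u :> seq 'I_d.+1
      & behead w == val v :> seq 'I_d.+1]].
Arguments deBruijn d M : clear implicits.
Arguments kautz d M : clear implicits.

(* Main.v *)
Require Import Defs.
From mathcomp Require Import all_boot.

(** Removing one vertex [w] leaves a zero forcing set, since any in-neighbour of
    [w] forces it. Removing two words that differ only in their last letter
    leaves a failed one: any vertex that may force has both of them or neither
    as out-neighbours. *)

Lemma fixed_FZFS (V : finType) (e : rel V) (S : {set V}) :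
  zf_step e S = S -> S != [set: V] -> is_FZFS e S.
Proof.
move=> fixS neST [t]; have -> : zf_iter e t S = S.
  by elim: t => //= t; rewrite /zf_iter => ->.
by move/eqP; rewrite (negPf neST).
Qed.

Lemma setC1_ZFS (V : finType) (e : rel V) (v w : V) :
  e v w -> is_ZFS e [set~ w].
Proof.
move=> evw; exists 1; apply/setP => x; rewrite /= !inE.
case: eqVneq => //= ->; apply/existsP; exists v; apply/andP; split.
  (* Without loops only a coloured vertex may force; [v] is one, since [v = w] would turn [evw] into
     a loop. *)
  have [//|nloop] := boolP (has_loop e); rewrite !inE /=.
  by apply: contraNneq nloop => vw; apply/existsP; exists w; rewrite -{1}vw.
by apply/eqP/setP => y; rewrite !inE negbK; case: eqVneq => //= ->.
Qed.

Lemma twins_FZFS (V : finType) (e : rel V) (a b : V) : a != b ->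
  (forall v, has_loop e || (v \notin [set a; b]) -> e v a = e v b) ->
  is_FZFS e (~: [set a; b]).
Proof.
move=> neab twins; apply: fixed_FZFS; last first.
  by apply/eqP => /setP /(_ a); rewrite !inE eqxx.
apply/setUidPl/subsetP => w; rewrite inE => /existsP[v /andP[force /eqP Nv]].
have eab : e v a = e v b by apply: twins; rewrite in_setC in force.
(* The uncoloured out-neighbours of [v] form [[set w]]. Testing [a] and [b] for membership shows
   that [w] equals both or neither. *)
have Nva : (a == w) = e v a by move/setP/(_ a): Nv; rewrite !inE eqxx.
have Nvb : (b == w) = e v b by move/setP/(_ b): Nv; rewrite !inE eqxx orbT.
rewrite !inE ![w == _]eq_sym Nva Nvb eab orbb -Nvb.
apply: contra neab => bw; have: a == w by rewrite Nva eab -Nvb.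
by rewrite (eqP bw).
Qed.

Lemma failed_zf_number_twins (V : finType) (e : rel V) (a b : V) :
  (forall w, exists v, e v w) -> a != b ->
  (forall v, has_loop e || (v \notin [set a; b]) -> e v a = e v b) ->
  failed_zf_number_is e (#|V| - 2).
Proof.
move=> indeg neab twins; split=> [|S failS].
  exists (~: [set a; b]); first exact: twins_FZFS.
  by rewrite cardsCs setCK cards2 neab.
(* In terms of complements: a failed set must miss at least two vertices, since missing one or none
   makes it zero forcing. *)
rewrite (cardsCs S) leq_sub2l // ltnNge.
apply/negP; rewrite leq_eqVlt ltnS leqn0 cards_eq0.
case/orP=> [/cards1P[w Sw] | /eqP S0]; apply: failS.
  by rewrite -[S]setCK Sw; have [v] := indeg w; apply: setC1_ZFS.
by exists 0; rewrite /= -[S]setCK S0 setC0.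
Qed.

(** The word behind the arc is [c :: v]. Only the first [m] letters of [v] constrain [u], so words
    differing in the last letter alone have the same in-neighbours. *)
Lemma deBruijn_arcP (d m : nat) (u v : deBruijn_vertex d m.+1) :
  reflect (exists c, u = c :: take m v :> seq 'I_d) (deBruijn d m.+1 u v).
Proof.
apply: (iffP existsP) => [[w /andP[/eqP <- /eqP <-]] | [c uE]].
  by case/tupleP: w => c t; exists c.
by exists (cons_tuple c v); rewrite /= uE !eqxx.
Qed.

Lemma kautz_arcP (d m : nat) (u v : kautz_vertex d m.+1) :
  reflect (exists2 c, val u = c :: take m (val v) :> seq 'I_d.+1
                    & kautz_word (c :: val v)) (kautz d m.+1 u v).
Proof.
apply: (iffP existsP) => [[w /and3P[kw /eqP <- /eqP vE]] | [c uE kcv]].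
  by case/tupleP: w vE kw => c t /= vE kw; exists c; rewrite -vE.
by exists (cons_tuple c (val v)); apply/and3P; split; rewrite ?uE.
Qed.

(** A loop at [v] would make [c] the first letter of [v], although the two are adjacent in a Kautz
    word. *)
Lemma kautz_loopless (d m : nat) : has_loop (kautz d m.+1) = false.
Proof.
apply/negbTE/existsP => -[v /kautz_arcP[c]].
by case: (val v) => -[|x s] //= _ [-> _]; rewrite /kautz_word /= eqxx.
Qed.

(** The alphabet has at least three letters, so a Kautz word can be continued in two ways; this is
    the source of the twins. *)
Lemma two_other_letters (d : nat) (z : 'I_d.+1) : 1 < d ->
  exists x y : 'I_d.+1, [/\ z != x, z != y & x != y].
Proof.
move=> hd; have : 1 < #|[set~ z]| by rewrite cardsC1 card_ord.
case/card_gt1P=> x [y [+ + nexy]]; rewrite !inE ![_ == z]eq_sym.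
by exists x, y.
Qed.

Lemma kautz_twin_words (d m : nat) : 1 < d ->
  exists q x y, [/\ size q = m, x != y,
    @kautz_word d (rcons q x) & @kautz_word d (rcons q y)].
Proof.
move=> hd; case: m => [|m].
  by have [x [y [_ _ nexy]]] := two_other_letters _ ord0 hd; exists [::], x, y.
have [p sz_p kp] : exists2 p, size p = m & kautz_word ((ord0 : 'I_d.+1) :: p).
  (* The starting letter is generalised because the tail starts from the new letter [x]. *)
  elim: m ord0 => [|m IHm] z; first by exists [::].
  have [x [_ [nezx _ _]]] := two_other_letters _ z hd.
  by have [p sz_p kp] := IHm x; exists (x :: p); rewrite /= ?sz_p // nezx.
have [x [y [nelx nely nexy]]] := two_other_letters _ (last ord0 p) hd.
exists (ord0 :: p), x, y; rewrite /kautz_word /= !rcons_path sz_p.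
by split=> //; apply/andP.
Qed.

(** If [q] is nonempty, [c] meets its first letter and the last letter is irrelevant. If [q] is
    empty, the digraph is complete without loops: [b] has an arc to [a] but none to itself, whence
    [v != b]. *)
Lemma kautz_twin_arc (d m : nat) (q : seq 'I_d.+1) (x y : 'I_d.+1)
    (a b v : kautz_vertex d m.+1) :
  val a = rcons q x :> seq _ -> val b = rcons q y :> seq _ -> v != b ->
  kautz d m.+1 v a -> kautz d m.+1 v b.
Proof.
move=> aE bE nevb /kautz_arcP[c vE kca]; apply/kautz_arcP.
have sz_q : size q = m.
  by apply/eqP; rewrite -eqSS -(size_rcons q x) -aE size_tuple.
move: vE kca; rewrite aE bE -!cats1 !take_size_cat // => vE kca.
exists c => //; have := valP b; rewrite bE.
case: q => [|h q] in aE bE sz_q vE kca * => kb.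
  rewrite /kautz_word /= andbT; apply: contra nevb => /eqP cy.
  by apply/eqP/val_inj/val_inj; rewrite /= vE bE cy.
by move: kca kb; rewrite /kautz_word /= -cats1 => /andP[-> _] ->.
Qed.

Lemma failed_zf_number_deBruijn (d m : nat) : 1 < d ->
  failed_zf_number_is (deBruijn d m.+1) (#|deBruijn_vertex d m.+1| - 2).
Proof.
case: d => [|[|d]] // _.
(* Twins of the form [0...0x]; [ord0] and [ord_max] are distinct as there are at least two
   letters. *)
pose word (x : 'I_d.+2) := rcons_tuple (nseq_tuple m ord0) x.
have wordE x : take m (word x) = nseq m ord0.
  by rewrite /= -cats1 take_size_cat ?size_nseq.
apply: (failed_zf_number_twins _ _ (word ord0) (word ord_max)) => [w||v _].
- have sz : size (ord0 :: take m w) == m.+1.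
    by rewrite /= size_takel // size_tuple.
  by exists (Tuple sz); apply/deBruijn_arcP; exists ord0.
- by rewrite -val_eqE /= eqseq_rcons eqxx.
- by apply/deBruijn_arcP/deBruijn_arcP => -[c]; rewrite !wordE; exists c;
    rewrite ?wordE.
Qed.

Lemma failed_zf_number_kautz (d m : nat) : 1 < d ->
  failed_zf_number_is (kautz d m.+1) (#|kautz_vertex d m.+1| - 2).
Proof.
move=> hd; have [q [x [y [sz_q nexy kx ky]]]] := kautz_twin_words d m hd.
have vertex (s : seq 'I_d.+1) : size s = m.+1 -> kautz_word s ->
    exists u : kautz_vertex d m.+1, val u = s :> seq _.
  by move=> /eqP sz ks; exists (Sub (Tuple sz) ks).
have [|a aE] := vertex _ _ kx; first by rewrite size_rcons sz_q.
have [|b bE] := vertex _ _ ky; first by rewrite size_rcons sz_q.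
apply: (failed_zf_number_twins _ _ a b) => [w||v].
- have sz_w := size_tuple (val w).
  (* An in-neighbour of [w] arises by prepending a letter other than its first and dropping the last
     one. *)
  have [c [_ [nec _ _]]] := two_other_letters _ (head ord0 (val w)) hd.
  have kcw : kautz_word (c :: val w).
    have := valP w; case: (tval (val w)) nec sz_w => //= h s nec _ kw.
    by rewrite /kautz_word /= eq_sym nec.
  have [||v vE] := vertex (take m.+1 (c :: val w)).
  + by rewrite size_takel //= sz_w.
  + exact: take_sorted.
  by exists v; apply/kautz_arcP; exists c.
- apply: contra nexy => /eqP ab; move/eqP: aE.
  by rewrite ab bE eqseq_rcons eqxx eq_sym.
(* Only vertices outside [[set a; b]] may force here; each of the two inequalities serves one
   direction. *)
- rewrite kautz_loopless !inE negb_or => /andP[neva nevb].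
  by apply/idP/idP; [apply: kautz_twin_arc aE bE nevb
                    | apply: kautz_twin_arc bE aE neva].
Qed.

Theorem corollary4p22 (d M : nat) (hd : 2 <= d) (hM : 1 <= M) :
  failed_zf_number_is (deBruijn d M) (#|deBruijn_vertex d M| - 2) /\
  failed_zf_number_is (kautz d M) (#|kautz_vertex d M| - 2).
Proof.
case: M hM => // m _.
by split; [apply: failed_zf_number_deBruijn | apply: failed_zf_number_kautz].
Qed.
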